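(* There exist a dictionary $\mathcal{D}$ in the real Hilbert space $\ell_2$ and an element $f\in A_1^o(\mathcal{D})$, which is a linear combination of two elements of the dictionary $\mathcal{D}$, such that for some realization of the Orthogonal Greedy Algorithm applied to $f$ with respect to $\mathcal{D}$, the residuals $f^o_m$ satisfy for all $m=1,2,\dots$ $$\|f^o_m\|=\frac{1}{\sqrt2}(m+1)^{-1/2}.$$
   Context: A dictionary in a real Hilbert space $H$ is a set $\mathcal{D}\subset H$ such that $\|g\|\le 1$ for every $g\in\mathcal{D}$, $g\in\mathcal{D}$ implies $-g\in\mathcal{D}$, and the closed linear span of $\mathcal{D}$ is $H$. $A_1^o(\mathcal{D}):=\{f\in H: f=\sum_{i=1}^\infty c_i g_i,\ g_i\in\mathcal{D},\ c_i\in\mathbb{R},\ \sum_{i=1}^\infty |c_i|\le 1\}$. Orthogonal Greedy Algorithm (OGA), which is the Weak Chebyshev Greedy Algorithm in a Hilbert space with weakness sequence identically $1$: set $f^o_0:=f$; for each $m\ge1$, choose $\varphi_m\in\mathcal{D}$ to be any element satisfying $\langle f^o_{m-1},\varphi_m\rangle\ge\sup_{g\in\mathcal{D}}\langle f^o_{m-1},g\rangle$, let $G^o_m$ be the orthogonal projection of $f$ onto $\operatorname{span}\{\varphi_1,\dots,\varphi_m\}$, and set $f^o_m:=f-G^o_m$. A realization of the OGA is a sequence produced by one particular admissible choice of $\varphi_1,\varphi_2,\dots$. *)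

(* Defs.v *)
From HB Require Import structures.
From mathcomp Require Import all_boot all_order all_algebra.
From mathcomp Require Import all_classical all_reals all_analysis.
From mathcomp Require Import ring lra.

Set Implicit Arguments.
Unset Strict Implicit.
Unset Printing Implicit Defensive.

Import Order.TTheory GRing.Theory Num.Theory.
Import numFieldNormedType.Exports.

Local Open Scope classical_set_scope.
Local Open Scope ring_scope.

Section ell2_carrier.
Variable R : realType.
Implicit Types u v : nat -> R.

Definition sqsummable : {pred nat -> R} :=
  fun u => `[< cvgn (series (fun n => u n ^+ 2)) >].

Lemma sqsummableP u :
  reflect (cvgn (series (fun n => u n ^+ 2))) (u \in sqsummable).
Proof. exact: asboolP. Qed.

Lemma sqsummable_mul u v : u \in sqsummable -> v \in sqsummable ->
  cvgn (series (fun n => u n * v n)).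
Proof.
move=> /sqsummableP su /sqsummableP sv; apply: normed_cvg.
apply: (@series_le_cvg _ _ ((fun n => u n ^+ 2) + (fun n => v n ^+ 2))).
- by move=> n; exact: normr_ge0.
- by move=> n; rewrite fctE addr_ge0 ?sqr_ge0.
- move=> n; rewrite fctE /= normrM -(real_normK (num_real (u n))).
  rewrite -(real_normK (num_real (v n))).
  have := normr_ge0 (u n); have := normr_ge0 (v n).
  have := sqr_ge0 (`|u n| - `|v n|).
  by move: `|u n| `|v n| => a b; nra.
- exact: is_cvg_seriesD.
Qed.

Lemma sqsummable_submod : submod_closed sqsummable.
Proof.
split.
  apply/sqsummableP; rewrite (_ : series _ = cst 0); first exact: is_cvg_cst.
  by apply/funext => n; rewrite /series/= big1// => i _; rewrite expr0n.
move=> a u v su sv; apply/sqsummableP.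
have suv := sqsummable_mul su sv.
move: su sv => /sqsummableP su /sqsummableP sv.
rewrite (_ : (fun n => _) = (a ^+ 2) *: (fun n => u n ^+ 2)
    + ((a *+ 2) *: (fun n => u n * v n) + (fun n => v n ^+ 2))).
  apply: is_cvg_seriesD; first exact: is_cvg_seriesZ.
  by apply: is_cvg_seriesD => //; exact: is_cvg_seriesZ.
apply/funext => n; rewrite !fctE /GRing.scale/= -mulr_natl; ring.
Qed.

HB.instance Definition _ :=
  GRing.isSubmodClosed.Build R (nat -> R) sqsummable sqsummable_submod.

End ell2_carrier.

Record ell2 (R : realType) := Ell2 {
  ell2_val :> nat -> R ;
  _ : ell2_val \in @sqsummable R }.

HB.instance Definition _ (R : realType) := [isSub for @ell2_val R].
HB.instance Definition _ (R : realType) := [Choice of ell2 R by <:].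
HB.instance Definition _ (R : realType) :=
  [SubChoice_isSubLmodule of ell2 R by <:].

Section ell2_inner_product.
Variable R : realType.
Implicit Types (u v w : ell2 R) (a : R).

Definition ell2_dot u v : R := limn (series (fun n => u n * v n)).

Lemma ell2_dot_cvg u v : cvgn (series (fun n => u n * v n)).
Proof. by case: u v => u su [v sv]; exact: sqsummable_mul. Qed.

Lemma ell2_dotC u v : ell2_dot u v = ell2_dot v u.
Proof.
by rewrite /ell2_dot (_ : (fun n => _) = (fun n => v n * u n))//;
  apply/funext => n; rewrite mulrC.
Qed.

Lemma ell2_dotDZl a u v w :
  ell2_dot (a *: u + v) w = a * ell2_dot u w + ell2_dot v w.
Proof.
rewrite /ell2_dot (_ : (fun n => _) =
    a *: (fun n => u n * w n) + (fun n => v n * w n)).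
  have uw := @ell2_dot_cvg u w; have vw := @ell2_dot_cvg v w.
  have auw : cvgn (series (a *: (fun n => u n * w n))) by exact: is_cvg_seriesZ.
  by rewrite (lim_seriesD auw vw) (lim_seriesZ _ uw).
by apply/funext => n; rewrite !fctE /GRing.scale/= mulrDl mulrA.
Qed.

Lemma ell2_dotDZr a u v w :
  ell2_dot w (a *: u + v) = a * ell2_dot w u + ell2_dot w v.
Proof. by rewrite ell2_dotC ell2_dotDZl !(ell2_dotC w). Qed.

Lemma ell2_dot0r u : ell2_dot u 0 = 0.
Proof. by have := ell2_dotDZr (-1) 0 0 u; rewrite scaler0 addr0; lra. Qed.

Lemma ell2_dot0l u : ell2_dot 0 u = 0.
Proof. by rewrite ell2_dotC ell2_dot0r. Qed.

Lemma ell2_dot_ge0 u : 0 <= ell2_dot u u.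
Proof.
apply: limr_ge; first exact: ell2_dot_cvg.
by apply: nearW => n; apply: sumr_ge0 => i _; rewrite -expr2 sqr_ge0.
Qed.

Lemma ell2_dot_eq0 u : ell2_dot u u = 0 -> u = 0.
Proof.
move=> u0; apply/val_inj/funext => n /=.
have : series (fun n => u n * u n) n.+1 <= ell2_dot u u.
  apply: nondecreasing_cvgn_le; last exact: ell2_dot_cvg.
  by apply/nondecreasing_series => i _ _; rewrite -expr2 sqr_ge0.
rewrite u0 /series/= big_nat_recr//= => un.
apply/eqP; rewrite -sqrf_eq0 eq_le sqr_ge0 andbT; apply: le_trans un.
rewrite expr2 lerDr.
by apply: sumr_ge0 => i _; rewrite -expr2 sqr_ge0.
Qed.

Lemma ell2_CauchySchwarz u v :
  ell2_dot u v ^+ 2 <= ell2_dot u u * ell2_dot v v.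
Proof.
have [/ell2_dot_eq0 ->|v0] := eqVneq (ell2_dot v v) 0.
  by rewrite !ell2_dot0r mulr0 expr0n.
have vgt0 : 0 < ell2_dot v v by rewrite lt_def v0 ell2_dot_ge0.
rewrite -(ler_pM2l vgt0) -subr_ge0.
have := ell2_dot_ge0 (ell2_dot v v *: u + ((- ell2_dot u v) *: v + 0)).
rewrite !(ell2_dotDZl, ell2_dotDZr) !(ell2_dot0r, ell2_dot0l) (ell2_dotC v u).
by lra.
Qed.

Definition ell2_norm u : R := Num.sqrt (ell2_dot u u).

Lemma ell2_normD u v : ell2_norm (u + v) <= ell2_norm u + ell2_norm v.
Proof.
rewrite /ell2_norm -[leRHS]ger0_norm ?addr_ge0 ?sqrtr_ge0// -sqrtr_sqr.
rewrite ler_wsqrtr// sqrrD !sqr_sqrtr ?ell2_dot_ge0//.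
have -> : ell2_dot (u + v) (u + v) =
    ell2_dot u u + ell2_dot u v *+ 2 + ell2_dot v v.
  rewrite -[u in u + v]scale1r !(ell2_dotDZl, ell2_dotDZr) (ell2_dotC v u).
  by rewrite -mulr_natl; ring.
rewrite lerD2r lerD2l lerMn2r/= -sqrtrM ?ell2_dot_ge0//.
by rewrite (le_trans (ler_norm _))// -sqrtr_sqr ler_wsqrtr// ell2_CauchySchwarz.
Qed.

Lemma ell2_normZ a u : ell2_norm (a *: u) = `|a| * ell2_norm u.
Proof.
rewrite /ell2_norm -[a *: u]addr0 !(ell2_dotDZl, ell2_dotDZr).
rewrite !(ell2_dot0r, ell2_dot0l) mulr0 !addr0 mulrA -expr2.
by rewrite sqrtrM ?sqr_ge0// sqrtr_sqr.
Qed.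

Lemma ell2_norm_eq0 u : ell2_norm u = 0 -> u = 0.
Proof.
move=> /eqP; rewrite sqrtr_eq0 => u0; apply: ell2_dot_eq0.
by apply/eqP; rewrite eq_le u0 ell2_dot_ge0.
Qed.

End ell2_inner_product.

HB.instance Definition _ (R : realType) :=
  Lmodule_isNormed.Build R (ell2 R)
    (@ell2_normD R) (@ell2_normZ R) (@ell2_norm_eq0 R).

Lemma ell2_normE (R : realType) (u : ell2 R) : `|u| = Num.sqrt (ell2_dot u u).
Proof. by []. Qed.

Definition lin_span (R : realType) (V : lmodType R) (A : set V) : set V :=
  [set x | exists (n : nat) (c : 'I_n -> R) (g : 'I_n -> V),
     (forall i, A (g i)) /\ x = \sum_(i < n) c i *: g i].

Section greedy.
Variable R : realType.
Notation H := (ell2 R).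
Implicit Types (D S : set H) (f p : H).

Definition is_dictionary D : Prop :=
  [/\ forall g, D g -> `|g| <= 1,
      forall g, D g -> D (- g) &
      closure (lin_span D) = [set: H]].

Definition A1o D : set H :=
  [set f | exists (c : nat -> R) (g : nat -> H),
     [/\ forall i, D (g i),
         (\sum_(0 <= i <oo) `|c i|%:E <= 1)%E &
         series (fun i => c i *: g i) @ \oo --> f]].

Definition is_orthogonal_projection S f p : Prop :=
  S p /\ forall s, S s -> ell2_dot (f - p) s = 0.

(** [phi m] and [r m] stand for $\varphi_m$ and $f^o_m$; the value [phi 0] is
    irrelevant. The supremum is a real [sup]: it is meaningful because a
    dictionary is nonempty and bounded in norm. *)
Definition OGA_realization D f (phi r : nat -> H) : Prop :=
  r 0%N = f /\
  forall m : nat, (1 <= m)%N ->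
    [/\ D (phi m),
        ell2_dot (r m.-1) (phi m) >= sup [set ell2_dot (r m.-1) g | g in D] &
        exists2 G : H,
          is_orthogonal_projection
            (lin_span [set phi i | i in [set i : nat | (1 <= i <= m)%N]]) f G &
          r m = f - G].

End greedy.

(* Main.v *)
Require Import Defs.
From HB Require Import structures.
From mathcomp Require Import all_boot all_order all_algebra.
From mathcomp Require Import all_classical all_reals all_analysis.
From mathcomp Require Import ring lra zify.

Import Order.TTheory GRing.Theory Num.Theory.
Import numFieldNormedType.Exports.

Local Open Scope classical_set_scope.
Local Open Scope ring_scope.

(** The example is a simplex seen from its apex. With [e] the standard
    orthonormal basis, take the atoms $\varphi_i = (e_0 + e_{i+1})/\sqrt2$, the
    reflected atom $\psi = (e_0 - e_1)/\sqrt2$, and their negatives, and the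
    target $f = e_0/\sqrt2 = (\varphi_0 + \psi)/2$. The $\varphi_i$ are unit
    vectors with all mutual inner products equal to 1/2, and they all have inner
    product 1/2 with $f$. By this symmetry the projection of $f$ onto the span
    of $m$ of them is a multiple of their sum, and the multiple is $1/(m+1)$
    ([residual_greedy_dot]). Since $\|f\|^2 = 1/2$, Pythagoras gives
    $\|f_m\|^2 = \langle f_m, f\rangle = 1/(2(m+1))$ ([residual_target_dot]).

    The reason why the greedy algorithm may never use $\varphi_0$ and $\psi$,
    although their mean is exactly $f$, is a tie: $f_m$ is orthogonal to the
    atoms already selected, and has the same inner product $1/(2(m+1))$ with
    every other $\varphi_j$ and with $\psi$ ([residual_sup]). Hence
    $\varphi_1, \varphi_2, \dots$ is an admissible selection.

    The span of the atoms contains every $e_i$, and truncations converge in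
    $\ell_2$, so the atoms form a dictionary ([dictionaryP]). *)

(** * Inner product and standard basis of $\ell_2$ *)

Section inner_product.
Variable R : realType.
Implicit Types (u v w x : ell2 R) (a : R) (i j n : nat).

Lemma ell2_dot_linear w : linear_for *%R (ell2_dot w).
Proof. by move=> a u v; rewrite ell2_dotDZr. Qed.

HB.instance Definition _ w :=
  GRing.isLinear.Build R (ell2 R) R *%R (ell2_dot w) (ell2_dot_linear w).

Lemma ell2_dotDl u v w : ell2_dot (u + v) w = ell2_dot u w + ell2_dot v w.
Proof. by rewrite !(ell2_dotC _ w) linearD. Qed.

Lemma ell2_dotNl u w : ell2_dot (- u) w = - ell2_dot u w.
Proof. by rewrite !(ell2_dotC _ w) linearN. Qed.

Lemma ell2_dotZl a u w : ell2_dot (a *: u) w = a * ell2_dot u w.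
Proof. by rewrite !(ell2_dotC _ w) linearZ. Qed.

Lemma ell2_dotDr u v w : ell2_dot w (u + v) = ell2_dot w u + ell2_dot w v.
Proof. exact: linearD. Qed.

Lemma ell2_dotNr u w : ell2_dot w (- u) = - ell2_dot w u.
Proof. exact: linearN. Qed.

Lemma ell2_dotZr a u w : ell2_dot w (a *: u) = a * ell2_dot w u.
Proof. exact: linearZ. Qed.

Lemma ell2_dot_sumr n (F : nat -> ell2 R) w :
  ell2_dot w (\sum_(i < n) F i) = \sum_(i < n) ell2_dot w (F i).
Proof. exact: raddf_sum. Qed.

Lemma ell2_dot_suml n (F : nat -> ell2 R) w :
  ell2_dot (\sum_(i < n) F i) w = \sum_(i < n) ell2_dot (F i) w.
Proof.
by rewrite ell2_dotC ell2_dot_sumr; apply: eq_bigr => i _; rewrite ell2_dotC.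
Qed.

Definition ell2_dotE :=
  (ell2_dotDl, ell2_dotNl, ell2_dotZl, ell2_dotDr, ell2_dotNr, ell2_dotZr).

(** Partial sums stop changing once the only nonzero term has been passed. Both
    the summability of the unit vectors and the inner product with a unit vector
    come from this. *)
Lemma series_single i (u : nat -> R) :
  \forall n \near \oo, series (fun k => u k * (k == i)%:R) n = u i.
Proof.
exists i.+1 => // n /= lt_in; rewrite /series /=.
rewrite (eq_bigr (fun k => if k == i then u k else 0)); last first.
  by move=> k _; case: eqP => _; rewrite ?mulr1 ?mulr0.
by rewrite -big_mkcond big_nat1_eq leq0n lt_in.
Qed.

Fact unit_vector_sqsummable i :
  (fun n => (n == i)%:R) \in @sqsummable R.
Proof.
apply/sqsummableP; apply: (@is_cvg_near_cst _ R (i == i)%:R).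
exact: (series_single i (fun k => (k == i)%:R)).
Qed.

Definition unit_vector i : ell2 R := Ell2 (unit_vector_sqsummable i).

Lemma ell2_dot_unit x i : ell2_dot x (unit_vector i) = x i.
Proof.
by apply: (@lim_near_cst R^o) => //; exact: (series_single i x).
Qed.

Lemma unit_vector_dot i j :
  ell2_dot (unit_vector i) (unit_vector j) = (i == j)%:R.
Proof. by rewrite ell2_dot_unit /= eq_sym. Qed.

Definition truncation x n : ell2 R := \sum_(i < n) x i *: unit_vector i.

Lemma truncation_coord x n i : (i < n)%N -> truncation x n i = x i.
Proof.
move=> lt_in; rewrite -(ell2_dot_unit (truncation x n)).
rewrite (ell2_dot_suml n (fun j => x j *: unit_vector j)).
rewrite (bigD1 (Ordinal lt_in)) //= big1 ?addr0 => [|j neq_ji].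
  by rewrite ell2_dotZl unit_vector_dot eqxx mulr1.
rewrite ell2_dotZl unit_vector_dot (_ : (_ == _) = false) ?mulr0 //.
by apply: contraNF neq_ji => /eqP eq_ji; apply/eqP/val_inj.
Qed.

Lemma ell2_dot_truncation x y n :
  ell2_dot y (truncation x n) = \sum_(i < n) x i * y i.
Proof.
rewrite (ell2_dot_sumr n (fun i => x i *: unit_vector i)).
by apply: eq_bigr => i _; rewrite ell2_dotZr ell2_dot_unit.
Qed.

(** The truncation is an orthogonal projection, so the squared error is the
    tail of the convergent series for [ell2_dot x x]. *)
Lemma truncation_cvg x : truncation x n @[n --> \oo] --> x.
Proof.
apply/subr_cvg0/norm_cvg0P.
have norm_tail n : `|truncation x n - x| =
    Num.sqrt (ell2_dot x x - series (fun k => x k * x k) n).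
  rewrite ell2_normE !ell2_dotE (ell2_dotC (truncation x n) x).
  rewrite !ell2_dot_truncation /series /= big_mkord; congr Num.sqrt.
  under eq_bigr => i _ do rewrite truncation_coord //.
  ring.
under eq_fun => n do rewrite norm_tail.
rewrite -(sqrtr0 R) -(subrr (ell2_dot x x)).
apply: (@cvg_comp _ _ _ _ (@Num.sqrt R)); last exact: sqrt_continuous.
by apply: cvgB; [exact: cvg_cst | exact: ell2_dot_cvg].
Qed.

End inner_product.

(** * Linear spans *)

Section linear_span.
Variables (R : realType) (V : lmodType R) (A : set V).

Lemma lin_span0 : lin_span A 0.
Proof. by exists 0%N, (fun=> 0), (fun=> 0); split => [[]//|];
  rewrite big_ord0. Qed.

Lemma lin_span_gen_add a g x : A g -> lin_span A x -> lin_span A (a *: g + x).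
Proof.
move=> Ag [n [c [h [Ah ->]]]].
(* The added term gets index 0; [unlift ord0] recovers the old indices. *)
exists n.+1, (fun i => oapp c a (unlift ord0 i)),
  (fun i => oapp h g (unlift ord0 i)); split.
  by move=> i; case: unliftP => [j|] _ //=; exact: Ah.
rewrite big_ord_recl unlift_none /=; congr (_ + _).
by apply: eq_bigr => i _; rewrite liftK.
Qed.

Lemma lin_spanD x y : lin_span A x -> lin_span A y -> lin_span A (x + y).
Proof.
move=> [n [c [h [Ah ->]]]] Ay; elim: n => [|n IHn] in c h Ah *.
  by rewrite big_ord0 add0r.
by rewrite big_ord_recl -addrA; apply: lin_span_gen_add => //; exact: IHn.
Qed.

Lemma lin_spanZ a x : lin_span A x -> lin_span A (a *: x).
Proof.
move=> [n [c [h [Ah ->]]]]; exists n, (fun i => a * c i), h; split => //.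
by rewrite scaler_sumr; apply: eq_bigr => i _; rewrite scalerA.
Qed.

Lemma lin_span_gen g : A g -> lin_span A g.
Proof.
move=> Ag; rewrite -[g]scale1r -[_ *: _]addr0.
exact/lin_span_gen_add/lin_span0.
Qed.

End linear_span.

(** Truncations are finite combinations of unit vectors, and every element of
    the space is a limit of its truncations. *)
Lemma closure_lin_span (R : realType) (D : set (ell2 R)) :
  (forall i, lin_span D (unit_vector R i)) ->
  closure (lin_span D) = [set: ell2 R].
Proof.
move=> De; apply/seteqP; split => // x _.
apply: (closed_cvg (closure (lin_span D)) (@closed_closure _ _))
  (truncation_cvg R x).
apply: nearW => n; apply: subset_closure.
rewrite /truncation; elim/big_ind: _ => [|u v|i _]; first exact: lin_span0.
- exact: lin_spanD.
- exact/lin_spanZ.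
Qed.

(** * The dictionary and the target *)

Section construction.
Variable R : realType.

Notation e := (unit_vector R).
Notation s := ((Num.sqrt 2)^-1 : R).

(** The algorithm is made to select the indices 1, 2, ...; index 0 is kept
    aside, since it represents the target together with [mirror_atom]. *)
Definition greedy_atom (i : nat) : ell2 R := s *: (e 0%N + e i.+1).
Definition mirror_atom : ell2 R := s *: (e 0%N - e 1%N).
Definition target : ell2 R := s *: e 0%N.
Definition atoms : set (ell2 R) :=
  [set g | range greedy_atom g \/ g = mirror_atom].
Definition dictionary : set (ell2 R) := [set g | atoms g \/ atoms (- g)].

Lemma inv_sqrt2_sqr : s * s = 2^-1.
Proof. by rewrite -expr2 exprVn sqr_sqrtr. Qed.

Lemma greedy_atom_dot i j :
  ell2_dot (greedy_atom i) (greedy_atom j) = 2^-1 * (1 + (i == j)%:R).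
Proof.
rewrite /greedy_atom ell2_dotZl ell2_dotZr mulrA inv_sqrt2_sqr.
by rewrite !ell2_dotE !unit_vector_dot eqSS /=; ring.
Qed.

Lemma mirror_atom_dot : ell2_dot mirror_atom mirror_atom = 1.
Proof.
rewrite /mirror_atom ell2_dotZl ell2_dotZr mulrA inv_sqrt2_sqr.
by rewrite !ell2_dotE !unit_vector_dot /=; lra.
Qed.

Lemma target_greedy_dot i : ell2_dot target (greedy_atom i) = 2^-1.
Proof.
rewrite /target /greedy_atom ell2_dotZl ell2_dotZr mulrA inv_sqrt2_sqr.
by rewrite !ell2_dotE !unit_vector_dot /=; ring.
Qed.

Lemma target_dot : ell2_dot target target = 2^-1.
Proof.
rewrite /target ell2_dotZl ell2_dotZr mulrA inv_sqrt2_sqr.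
by rewrite !unit_vector_dot /=; ring.
Qed.

Lemma target_mean : target = 2^-1 *: greedy_atom 0 + 2^-1 *: mirror_atom.
Proof.
rewrite /target /greedy_atom /mirror_atom -scalerDr -scalerDr addrACA addrN.
by rewrite addr0 -mulr2n -(scaler_nat 2 (e 0%N)) !scalerA mulrAC mulVf ?mul1r.
Qed.

Lemma greedy_neq_mirror : greedy_atom 0 <> mirror_atom.
Proof.
move=> /(congr1 (fun x => ell2_dot x (greedy_atom 0))).
rewrite greedy_atom_dot /mirror_atom /greedy_atom ell2_dotZl ell2_dotZr mulrA.
rewrite inv_sqrt2_sqr.
by rewrite !ell2_dotE !unit_vector_dot /=; lra.
Qed.

Lemma dictionary_greedy i : dictionary (greedy_atom i).
Proof. by left; left; exists i. Qed.

Lemma dictionary_mirror : dictionary mirror_atom.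
Proof. by left; right. Qed.

Lemma atoms_norm g : atoms g -> `|g| = 1.
Proof.
rewrite ell2_normE => -[[i _ <-]|->].
  by rewrite greedy_atom_dot eqxx (_ : _ * _ = 1) ?sqrtr1 //=; lra.
by rewrite mirror_atom_dot sqrtr1.
Qed.

Lemma dictionaryP : is_dictionary dictionary.
Proof.
split.
- by move=> g [/atoms_norm-> //|/atoms_norm]; rewrite normrN => ->.
- by move=> g [?|?]; [right; rewrite opprK|left].
have s_unscale x : Num.sqrt 2 *: (s *: x) = x :> ell2 R.
  by rewrite scalerA mulfV ?scale1r // sqrtr_eq0 -ltNge.
(* [e 0] comes from [target], and each other unit vector is then what remains
   of an atom once [e 0] is removed. *)
have span_e0 : lin_span dictionary (e 0%N).
  rewrite -[e 0%N]s_unscale; apply: lin_spanZ; rewrite -/target target_mean.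
  by apply: lin_spanD; apply/lin_spanZ/lin_span_gen;
    [exact: dictionary_greedy|exact: dictionary_mirror].
apply: closure_lin_span => -[//|i].
rewrite (_ : e i.+1 = Num.sqrt 2 *: greedy_atom i + (-1) *: e 0%N).
  apply: lin_spanD; apply: lin_spanZ => //; apply: lin_span_gen.
  exact: dictionary_greedy.
by rewrite s_unscale scaleN1r addrAC addrN add0r.
Qed.

Lemma A1o_mean (D : set (ell2 R)) g1 g2 : D g1 -> D g2 ->
  A1o D (2^-1 *: g1 + 2^-1 *: g2).
Proof.
move=> Dg1 Dg2.
exists (fun i => if (i < 2)%N then 2^-1 else 0),
  (fun i => if i == 0%N then g1 else g2).
split; first by case.
- apply: lime_le; first by apply: is_cvg_nneseries.
  exists 2%N => // n /= n2.
  rewrite sumEFin lee_fin (big_cat_nat _ _ (n := 2)) //=.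
  rewrite [X in _ + X]big_nat_cond [X in _ + X]big1; last first.
    by move=> i; rewrite andbT => /andP[i2 _]; rewrite ltnNge i2 normr0.
  rewrite big_nat_recr //= big_nat1 /= ger0_norm ?invr_ge0 //.
  lra.
- apply: cvg_near_cst; exists 2%N => // n /= n2.
  rewrite /series /= (big_cat_nat _ _ (n := 2)) //=.
  rewrite [X in _ + X]big_nat_cond [X in _ + X]big1; last first.
    by move=> i; rewrite andbT => /andP[i2 _]; rewrite ltnNge i2 scale0r.
  by rewrite big_nat_recr //= big_nat1 /= addr0.
Qed.

(** * The residuals *)

Definition approximant m : ell2 R :=
  \sum_(i < m) m.+1%:R^-1 *: greedy_atom i.+1.
Definition residual m : ell2 R := target - approximant m.

Lemma sum_indicatorS m j :
  (\sum_(i < m) (i.+1 == j)%:R : R) = (0 < j <= m)%N%:R.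
Proof.
elim: m => [|m IHm]; first by rewrite big_ord0; case: j.
rewrite big_ord_recr /= IHm -natrD; congr (_%:R).
by case: eqP => [<-|ne]; lia.
Qed.

(** Against a $\varphi_j$, the approximant contributes $m$ inner products 1/2,
    plus another 1/2 when $\varphi_j$ is one of its own terms. So the value is
    $\frac12 - \frac{m}{2(m+1)}$, or $\frac12 - \frac{m+1}{2(m+1)} = 0$; the
    factor $1/(m+1)$ in [approximant] is what makes the latter vanish. *)
Lemma residual_greedy_dot m j :
  ell2_dot (residual m) (greedy_atom j) =
    if (0 < j <= m)%N then 0 else (2 * m.+1%:R)^-1.
Proof.
have m1 : m%:R + 1 != 0 :> R by rewrite natr1.
rewrite /residual ell2_dotDl ell2_dotNl target_greedy_dot.
rewrite (ell2_dot_suml R m (fun i => m.+1%:R^-1 *: greedy_atom i.+1)).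
under eq_bigr => i _ do rewrite ell2_dotZl greedy_atom_dot.
rewrite -mulr_sumr -mulr_sumr big_split /= sum_indicatorS sumr_const card_ord.
by rewrite -natr1; case: ifP => _ /=; field.
Qed.

Lemma residual_approximant_dot m n : (n <= m)%N ->
  ell2_dot (residual m) (approximant n) = 0.
Proof.
move=> nm.
rewrite (ell2_dot_sumr R n (fun i => n.+1%:R^-1 *: greedy_atom i.+1)).
apply: big1 => i _; rewrite ell2_dotZr residual_greedy_dot.
by rewrite (leq_trans (ltn_ord i) nm) mulr0.
Qed.

Lemma residual_target_dot m :
  ell2_dot (residual m) target = (2 * m.+1%:R)^-1.
Proof.
have m1 : m%:R + 1 != 0 :> R by rewrite natr1.
rewrite /residual ell2_dotDl ell2_dotNl target_dot.
rewrite (ell2_dot_suml R m (fun i => m.+1%:R^-1 *: greedy_atom i.+1)).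
under eq_bigr => i _ do rewrite ell2_dotZl ell2_dotC target_greedy_dot.
by rewrite sumr_const card_ord -natr1 -mulr_natr; field.
Qed.

(** The target is the mean of [greedy_atom 0] and [mirror_atom], and the
    residual has the same inner product with the target as with
    [greedy_atom 0]; the remaining atom must then give that value as well. *)
Lemma residual_mirror_dot m :
  ell2_dot (residual m) mirror_atom = (2 * m.+1%:R)^-1.
Proof.
have := residual_target_dot m.
rewrite target_mean ell2_dotDr (ell2_dotZr R 2^-1 (greedy_atom 0)).
rewrite (ell2_dotZr R 2^-1 mirror_atom) residual_greedy_dot /=.
by move: (2 * _)^-1 => t; lra.
Qed.

(** On the unsigned atoms the inner products with the residual take only the
    values 0 and $1/(2(m+1))$. As these are nonnegative, the opposite atoms
    cannot do better. *)
Lemma residual_sup m :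
  sup [set ell2_dot (residual m) g | g in dictionary] <= (2 * m.+1%:R)^-1.
Proof.
apply: ge_sup.
  by exists (ell2_dot (residual m) mirror_atom), mirror_atom => //;
    exact: dictionary_mirror.
have t_ge0 : 0 <= (2 * m.+1%:R)^-1 :> R by rewrite invr_ge0 mulr_ge0.
have atoms_dot g : atoms g -> 0 <= ell2_dot (residual m) g <= (2 * m.+1%:R)^-1.
  move=> [[j _ <-]|->]; last by rewrite residual_mirror_dot t_ge0 lexx.
  by rewrite residual_greedy_dot; case: ifP => _; rewrite !(t_ge0, lexx).
move=> _ [g [] /atoms_dot + <-]; first by case/andP.
by rewrite ell2_dotNr => /andP[+ _]; rewrite oppr_ge0 => /le_trans; apply.
Qed.

(** The residual is orthogonal to the approximant, so its squared norm is its
    inner product with the target. *)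
Lemma residual_norm m :
  `|residual m| = (Num.sqrt 2)^-1 * (m.+1%:R `^ (- 2^-1)).
Proof.
rewrite ell2_normE {2}/residual ell2_dotDr ell2_dotNr.
rewrite residual_approximant_dot // residual_target_dot subr0 powRN.
rewrite powR12_sqrt // -invfM -sqrtrM //.
by rewrite sqrtrV // mulr_ge0.
Qed.

Lemma residual_OGA : OGA_realization dictionary target greedy_atom residual.
Proof.
split; first by rewrite /residual /approximant big_ord0 subr0.
move=> [//|m] _; split; first exact: dictionary_greedy.
  by rewrite /= residual_greedy_dot /= ltnn; exact: residual_sup.
exists (approximant m.+1) => //; split.
  exists m.+1, (fun=> m.+2%:R^-1), (fun i => greedy_atom i.+1); split => // i.
  by exists i.+1 => //=.
move=> _ [n [c [g [phi_g ->]]]]; rewrite -/(residual m.+1) raddf_sum.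
apply: big1 => i _ /=; have [j /= j_le <-] := phi_g i.
by rewrite ell2_dotZr residual_greedy_dot j_le mulr0.
Qed.

End construction.

Theorem theorem3p3 (R : realType) :
  exists (D : set (ell2 R)) (f : ell2 R),
    [/\ is_dictionary D,
        A1o D f,
        exists (g1 g2 : ell2 R) (a b : R),
          [/\ D g1, D g2, g1 <> g2 & f = a *: g1 + b *: g2] &
        exists phi r : nat -> ell2 R,
          OGA_realization D f phi r /\
          forall m : nat, (1 <= m)%N ->
            `|r m| = (Num.sqrt 2)^-1 * (m.+1%:R `^ (- 2^-1))].
Proof.
exists (dictionary R), (target R); split.
- exact: dictionaryP.
- rewrite target_mean.
  by apply: A1o_mean; [exact: dictionary_greedy|exact: dictionary_mirror].
- exists (greedy_atom R 0), (mirror_atom R), 2^-1, 2^-1; split.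
  + exact: dictionary_greedy.
  + exact: dictionary_mirror.
  + exact: greedy_neq_mirror.
  + exact: target_mean.
- exists (greedy_atom R), (residual R); split; first exact: residual_OGA.
  by move=> m _; exact: residual_norm.
Qed.
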